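(* Let $\mathfrak V$ be a variety of algebras over a field $\mathbf F$ generated by a finite family $\mathcal A=\{A_1,\dots,A_m\}$ of finite algebras. Then the following are equivalent. (i) All finite algebras of $\mathfrak V$ are projective in $\mathfrak V$. (ii) All finite algebras of $\mathfrak V$ are nice. (iii) All algebras of $\mathcal A$ are nice.
   Context: An algebra over a field $\mathbf F$ is a vector space over $\mathbf F$ with a bilinear multiplication (not assumed associative, commutative or unital). The variety generated by a family $\mathcal A$ of $\mathbf F$-algebras is the class of all $\mathbf F$-algebras satisfying every identity $v(x_1,\dots,x_n)=0$ that holds in all algebras of $\mathcal A$, where $v$ ranges over nonassociative polynomials over $\mathbf F$ without constant term. An algebra $F\in\mathfrak V$ is $\mathfrak V$-free on a generating set $X\subset F$ if every map from $X$ to an algebra $P\in\mathfrak V$ extends to a homomorphism $F\to P$. An algebra $B\in\mathfrak V$ is projective in $\mathfrak V$ if it is (isomorphic to) a retract of a $\mathfrak V$-free algebra; equivalently, for every surjective homomorphism $\alpha:A\to B$ with $A\in\mathfrak V$ there is a homomorphism $\beta:B\to A$ with $\alpha\beta=\mathrm{id}_B$. A two-sided ideal $I$ of an algebra $B$ is semidirectly complementable in $B$ if there is a subalgebra $C$ of $B$ with $B=C+I$ and $C\cap I=\{0\}$. An algebra $A$ is nice if every ideal $I$ of every subalgebra $B\subset A$ is semidirectly complementable in $B$. *)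

(* Defs.v *)
From mathcomp Require Import all_boot all_order all_algebra.
From mathcomp Require Import boolp classical_sets functions cardinality.

Set Implicit Arguments.
Unset Strict Implicit.
Unset Printing Implicit Defensive.

Import GRing.Theory.

Local Open Scope classical_set_scope.
Local Open Scope ring_scope.

(* MathComp's algType is associative and unital, hence this record. *)
Record nalgType (F : fieldType) := NAlg {
  nalg_sort :> lmodType F;
  nmul : {bilinear nalg_sort -> nalg_sort -> nalg_sort} }.

Notation "x ** y" := (nmul _ x y) (at level 40, left associativity).

Definition is_nalg_hom (F : fieldType) (A B : nalgType F) (f : A -> B) : Prop :=
  linear f /\ {morph f : x y / x ** y}.

Definition finite_nalg (F : fieldType) (A : nalgType F) : Prop :=
  finite_set [set: A].

Definition is_subspace (F : fieldType) (A : nalgType F) (S : set A) : Prop :=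
  S 0 /\ forall (a : F) (x y : A), S x -> S y -> S (a *: x + y).

Definition is_subalgebra (F : fieldType) (A : nalgType F) (B : set A) : Prop :=
  is_subspace B /\ forall x y : A, B x -> B y -> B (x ** y).

Definition is_ideal_of (F : fieldType) (A : nalgType F) (B I : set A) : Prop :=
  [/\ I `<=` B, is_subspace I &
      forall b i : A, B b -> I i -> I (b ** i) /\ I (i ** b)].

Definition semidirectly_complementable (F : fieldType) (A : nalgType F)
    (B I : set A) : Prop :=
  exists C : set A, [/\ is_subalgebra C, C `<=` B,
    B = [set c + i | c in C & i in I] & C `&` I = [set 0]].

Definition nice (F : fieldType) (A : nalgType F) : Prop :=
  forall B I : set A, is_subalgebra B -> is_ideal_of B I ->
    semidirectly_complementable B I.

(* Nonassociative monomials are the nonempty bracketed words. *)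
Inductive namonom (X : Type) : Type :=
| NVar of X
| NProd of namonom X & namonom X.

Arguments NVar {X} _.
Arguments NProd {X} _ _.

Fixpoint monom_eval (F : fieldType) (A : nalgType F) (X : Type) (e : X -> A)
    (w : namonom X) : A :=
  match w with
  | NVar x => e x
  | NProd u v => monom_eval e u ** monom_eval e v
  end.

(* [:: (c_1, w_1); ...; (c_k, w_k)] stands for c_1 w_1 + ... + c_k w_k. The
   representation is not unique; the empty word is not a monomial, so there is
   no constant term. *)
Definition napoly (F : fieldType) (n : nat) : Type := seq (F * namonom 'I_n).

Definition napoly_eval (F : fieldType) (A : nalgType F) (n : nat)
    (e : 'I_n -> A) (v : napoly F n) : A :=
  \sum_(cw <- v) cw.1 *: monom_eval e cw.2.

Definition satisfies_identity (F : fieldType) (A : nalgType F) (n : nat)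
    (v : napoly F n) : Prop :=
  forall e : 'I_n -> A, napoly_eval e v = 0.

Definition generated_variety (F : fieldType) (J : Type) (A : J -> nalgType F) :
    nalgType F -> Prop :=
  fun P => forall (n : nat) (v : napoly F n),
    (forall j : J, satisfies_identity (A j) v) -> satisfies_identity P v.

Definition generates (F : fieldType) (L : nalgType F) (X : set L) : Prop :=
  forall S : set L, is_subalgebra S -> X `<=` S -> S = [set: L].

(* A map X -> P is given by a total function L -> P of which only the values
   on X matter. *)
Definition free_on (F : fieldType) (V : nalgType F -> Prop) (L : nalgType F)
    (X : set L) : Prop :=
  [/\ V L, generates X &
      forall (P : nalgType F) (f : L -> P), V P ->
        exists h : L -> P, is_nalg_hom h /\ {in X, h =1 f}].

Definition projective_in (F : fieldType) (V : nalgType F -> Prop)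
    (B : nalgType F) : Prop :=
  V B /\
  exists (L : nalgType F) (X : set L) (s : B -> L) (r : L -> B),
    [/\ free_on V X, is_nalg_hom s, is_nalg_hom r & cancel s r].

(* Main.v *)
Require Import Defs.
From HB Require Import structures.
From mathcomp Require Import all_boot all_order all_algebra.
From mathcomp Require Import boolp classical_sets functions cardinality.

(* If finite algebras of the variety are projective, the projection D -> D/I
   splits for an ideal I of a subalgebra D of a finite algebra, and the image
   of a splitting complements I. Conversely, a relatively free algebra of
   finite rank is separated by finitely many homomorphisms to the A_j. Such an
   algebra is nice when the A_j are: the ideal can be complemented along one
   homomorphism at a time. A finite algebra is the image of a relatively free
   algebra of finite rank, and a complement of the kernel makes it a retract. *)

Set Implicit Arguments.
Unset Strict Implicit.
Unset Printing Implicit Defensive.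

Import GRing.Theory.

Local Open Scope classical_set_scope.
Local Open Scope ring_scope.

(** * Closure properties of subspaces *)

Section Subspaces.
Variables (F : fieldType) (A : nalgType F) (S : set A).
Hypothesis subS : is_subspace S.

Lemma subspace0 : S 0. Proof. by case: subS. Qed.

Lemma subspaceZ a x : S x -> S (a *: x).
Proof. by move=> Sx; rewrite -[_ *: _]addr0; apply: subS.2 => //; apply: subspace0. Qed.

Lemma subspaceD x y : S x -> S y -> S (x + y).
Proof. by move=> Sx Sy; rewrite -[x]scale1r; apply: subS.2. Qed.

Lemma subspaceN x : S x -> S (- x).
Proof. by rewrite -scaleN1r; apply: subspaceZ. Qed.

Lemma subspaceB x y : S x -> S y -> S (x - y).
Proof. by move=> Sx Sy; apply: subspaceD => //; apply: subspaceN. Qed.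

Lemma subspace_sum (T : Type) (r : seq T) (f : T -> A) :
  (forall i, S (f i)) -> S (\sum_(i <- r) f i).
Proof. by move=> Sf; elim/big_ind: _ => //; [apply: subspace0|apply: subspaceD]. Qed.

End Subspaces.

(** * Homomorphisms, with images and preimages of subalgebras and ideals *)

Section Homs.
Variables (F : fieldType).
Implicit Types A B C : nalgType F.

Section OneHom.
Variables (A B : nalgType F) (f : A -> B).
Hypothesis hf : is_nalg_hom f.

Lemma homD : {morph f : x y / x + y}.
Proof. by move=> x y; have := hf.1 1 x y; rewrite !scale1r. Qed.

Lemma hom0 : f 0 = 0.
Proof. by apply: (addrI (f 0)); rewrite -homD !addr0. Qed.

Lemma homZ a : {morph f : x / a *: x}.
Proof. by move=> x; have := hf.1 a x 0; rewrite hom0 !addr0. Qed.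

Lemma homB : {morph f : x y / x - y}.
Proof. by move=> x y; rewrite homD -scaleN1r homZ scaleN1r. Qed.

Lemma homM : {morph f : x y / x ** y}.
Proof. exact: hf.2. Qed.

Lemma hom_monom_eval (X : Type) (e : X -> A) (w : namonom X) :
  f (monom_eval e w) = monom_eval (f \o e) w.
Proof. by elim: w => //= u <- v <-; rewrite homM. Qed.

Lemma hom_napoly_eval n (e : 'I_n -> A) (v : napoly F n) :
  f (napoly_eval e v) = napoly_eval (f \o e) v.
Proof.
rewrite /napoly_eval (big_morph f homD hom0).
by apply: eq_bigr => cw _; rewrite homZ hom_monom_eval.
Qed.

Lemma preimage_subalgebra (S : set B) :
  is_subalgebra S -> is_subalgebra (f @^-1` S).
Proof.
move=> [[S0 Sl] Sm]; split; first split=> [|a x y] /=.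
- by rewrite hom0.
- by rewrite hf.1; apply: Sl.
- by move=> x y /=; rewrite homM; apply: Sm.
Qed.

Lemma image_subalgebra (S : set A) :
  is_subalgebra S -> is_subalgebra (f @` S).
Proof.
move=> [[S0 Sl] Sm]; split; first split.
- by exists 0; rewrite ?hom0.
- by move=> a _ _ [x Sx <-] [y Sy <-]; exists (a *: x + y); rewrite ?hf.1 //; apply: Sl.
- by move=> _ _ [x Sx <-] [y Sy <-]; exists (x ** y); rewrite ?homM //; apply: Sm.
Qed.

Lemma image_ideal (D I : set A) :
  is_ideal_of D I -> is_ideal_of (f @` D) (f @` I).
Proof.
move=> [ID [I0 Il] Im]; split.
- by move=> _ [x /ID Dx <-]; exists x.
- split; first by exists 0; rewrite ?hom0.
  by move=> a _ _ [x Sx <-] [y Sy <-]; exists (a *: x + y); rewrite ?hf.1 //; apply: Il.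
- move=> _ _ [b Db <-] [i Ii <-]; have [bi ib] := Im _ _ Db Ii.
  by split; [exists (b ** i)|exists (i ** b)]; rewrite ?homM.
Qed.

End OneHom.

Lemma hom_comp A B C (f : A -> B) (g : B -> C) :
  is_nalg_hom f -> is_nalg_hom g -> is_nalg_hom (g \o f).
Proof.
move=> hf hg; split=> [a x y|x y] /=; first by rewrite hf.1 hg.1.
by rewrite (homM hf) (homM hg).
Qed.

Lemma subalgebraT A : is_subalgebra [set: A]. Proof. by []. Qed.

Lemma equalizer_subalgebra A B (f g : A -> B) :
  is_nalg_hom f -> is_nalg_hom g -> is_subalgebra [set x | f x = g x].
Proof.
move=> hf hg; split; first split=> [|a x y] /=.
- by rewrite !hom0.
- by rewrite hf.1 hg.1 => -> ->.
- by move=> x y /=; rewrite !homM // => -> ->.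
Qed.

Lemma subalgebraI A (S T : set A) :
  is_subalgebra S -> is_subalgebra T -> is_subalgebra (S `&` T).
Proof.
move=> [[S0 Sl] Sm] [[T0 Tl] Tm]; split; first split=> //.
- by move=> a x y [? ?] [? ?]; split; [apply: Sl|apply: Tl].
- by move=> x y [? ?] [? ?]; split; [apply: Sm|apply: Tm].
Qed.

End Homs.

(** * Bilinearity of the multiplication *)

Section Products.
Variables (F : fieldType) (A : nalgType F).
Implicit Types x y z : A.

Lemma nmul0l y : (0 : A) ** y = 0. Proof. exact: linear0l. Qed.
Lemma nmul0r x : x ** 0 = 0. Proof. exact: linear0r. Qed.
Lemma nmulDl x y z : (x + y) ** z = x ** z + y ** z. Proof. exact: linearDl. Qed.
Lemma nmulDr x y z : x ** (y + z) = x ** y + x ** z. Proof. exact: linearDr. Qed.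
Lemma nmulBl x y z : (x - y) ** z = x ** z - y ** z. Proof. exact: linearBl. Qed.
Lemma nmulBr x y z : x ** (y - z) = x ** y - x ** z. Proof. exact: linearBr. Qed.
Lemma nmulZl a x y : (a *: x) ** y = a *: (x ** y). Proof. exact: linearZl_LR. Qed.
Lemma nmulZr a x y : x ** (a *: y) = a *: (x ** y). Proof. exact: linearZr. Qed.

End Products.

(** * Algebras from a bilinear operation on a vector space *)

Section BuildAlgebra.
Variables (F : fieldType) (V : lmodType F) (m : V -> V -> V).
Hypotheses (ml : forall a x y z, m (a *: x + y) z = a *: m x z + m y z)
           (mr : forall a x y z, m z (a *: x + y) = a *: m z x + m z y).

Fact mul_is_bilinear : bilinear_for *:%R *:%R m.
Proof. by split=> [z a x y|z a x y] /=; rewrite ?ml ?mr. Qed.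

HB.instance Definition _ := bilinear_isBilinear.Build F V V V _ _ m mul_is_bilinear.

Definition nalg_of_mul : nalgType F := NAlg m.

End BuildAlgebra.

(** * The quotient of a subalgebra by an ideal *)

Section Subquotient.
Variables (F : fieldType) (A : nalgType F) (B I : set A).
Hypotheses (subB : is_subalgebra B) (idI : is_ideal_of B I).

Let subspB : is_subspace B := subB.1.
Let IB : I `<=` B. Proof. by case: idI. Qed.
Let subI : is_subspace I. Proof. by case: idI. Qed.
Let IMl b i : B b -> I i -> I (b ** i).
Proof. by case: idI => _ _ Im Bb Ii; case: (Im _ _ Bb Ii). Qed.
Let IMr b i : B b -> I i -> I (i ** b).
Proof. by case: idI => _ _ Im Bb Ii; case: (Im _ _ Bb Ii). Qed.

(** The set is the coset of [x] and contains [x], so the default 0 is never a fallback. The choice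
    depends on the set alone, which makes it constant on cosets. *)
Definition coset_repr (x : A) : A := xget 0 [set y | I (x - y)].

Lemma coset_reprP x : I (x - coset_repr x).
Proof.
by rewrite /coset_repr; case: xgetP => // /(_ x) /=; rewrite subrr => /(_ (subspace0 subI)).
Qed.

Lemma coset_repr_eq x y : I (x - y) -> coset_repr x = coset_repr y.
Proof.
move=> Ixy; rewrite /coset_repr; congr xget; apply/seteqP; split=> z /= Iz.
  have -> : y - z = (x - z) - (x - y) by rewrite opprB [RHS]addrC subrKA.
  exact: subspaceB.
by rewrite -(subrKA y); apply: subspaceD.
Qed.

Lemma coset_repr_sub x : B x -> B (coset_repr x).
Proof.
by move=> Bx; rewrite -[coset_repr x](subKr x); apply: subspaceB => //; apply/IB/coset_reprP.
Qed.

(* The cosets x + I, x in B, are encoded by their chosen representatives. *)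
Definition subquot := {x : A | `[< B x /\ coset_repr x = x >]}.

HB.instance Definition _ := Choice.on subquot.

Lemma coset_subproof (x : A) :
  let y := coset_repr (if `[< B x >] then x else 0) in
  `[< B y /\ coset_repr y = y >].
Proof.
have [Bx|_] := asboolP (B x); apply/asboolP; split.
- exact: coset_repr_sub.
- by apply/esym/coset_repr_eq/coset_reprP.
- exact/coset_repr_sub/(subspace0 subspB).
- by apply/esym/coset_repr_eq/coset_reprP.
Qed.

(* An x outside B is sent to the junk value 0 + I. *)
Definition coset (x : A) : subquot :=
  exist (fun y => `[< B y /\ coset_repr y = y >]) _ (coset_subproof x).

Lemma subquot_val (u : subquot) : B (val u).
Proof. by case: u => x /= /asboolP[]. Qed.

Lemma coset_valK (u : subquot) : coset (val u) = u.
Proof.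
apply: val_inj => /=; case: u => x /= /asboolP[Bx xE].
by rewrite asboolT.
Qed.

Lemma val_coset x : B x -> val (coset x) = coset_repr x.
Proof. by move=> Bx /=; rewrite asboolT. Qed.

Lemma val_cosetP x : B x -> I (x - val (coset x)).
Proof. by move/val_coset->; apply: coset_reprP. Qed.

Lemma coset_eq x y : B x -> B y -> coset x = coset y <-> I (x - y).
Proof.
move=> Bx By; split=> [xy|Ixy].
  rewrite -(subrKA (val (coset x))); apply: subspaceD => //; first exact: val_cosetP.
  by rewrite xy -opprB; apply: subspaceN => //; apply: val_cosetP.
by apply: val_inj; rewrite !val_coset //; apply: coset_repr_eq.
Qed.

(** Used with [elim/cosetW] as an induction principle: laws of the quotient reduce to laws of [A] on
    elements of [B]. *)
Lemma cosetW (P : subquot -> Prop) :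
  (forall x, B x -> P (coset x)) -> forall u, P u.
Proof. by move=> PB u; rewrite -[u]coset_valK; apply/PB/subquot_val. Qed.

Definition subquot_add (u v : subquot) := coset (val u + val v).
Definition subquot_opp (u : subquot) := coset (- val u).
Definition subquot_scale (a : F) (u : subquot) := coset (a *: val u).
Definition subquot_mul (u v : subquot) := coset (val u ** val v).

Let BD x y : B x -> B y -> B (x + y). Proof. exact: subspaceD. Qed.
Let BZ a x : B x -> B (a *: x). Proof. exact: subspaceZ. Qed.
Let BN x : B x -> B (- x). Proof. exact: subspaceN. Qed.
Let BM x y : B x -> B y -> B (x ** y). Proof. exact: subB.2. Qed.
Let Bv x : B x -> B (val (coset x)). Proof. by move=> _; apply: subquot_val. Qed.

Lemma cosetD x y : B x -> B y -> subquot_add (coset x) (coset y) = coset (x + y).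
Proof.
move=> Bx By; apply/esym/coset_eq; [exact: BD|by apply: BD; apply: Bv|].
by rewrite opprD addrACA; apply: subspaceD => //; apply: val_cosetP.
Qed.

Lemma cosetN x : B x -> subquot_opp (coset x) = coset (- x).
Proof.
move=> Bx; apply/esym/coset_eq; [exact: BN|exact/BN/Bv|].
by rewrite -opprD; apply: subspaceN => //; apply: val_cosetP.
Qed.

Lemma cosetZ a x : B x -> subquot_scale a (coset x) = coset (a *: x).
Proof.
move=> Bx; apply/esym/coset_eq; [exact: BZ|exact/BZ/Bv|].
by rewrite -scalerBr; apply: subspaceZ => //; apply: val_cosetP.
Qed.

Lemma cosetM x y : B x -> B y -> subquot_mul (coset x) (coset y) = coset (x ** y).
Proof.
move=> Bx By; apply/esym/coset_eq; [exact: BM|by apply: BM; apply: Bv|].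
(* With x', y' the representatives, xy - x'y' = x(y - y') + (x - x')y'; the two summands lie in [I]
   because the ideal is two-sided. *)
rewrite -(subrKA (x ** val (coset y))) -nmulBr -nmulBl.
apply: subspaceD => //; first by apply: IMl => //; apply: val_cosetP.
by apply: IMr; [apply: Bv|apply: val_cosetP].
Qed.

Fact subquot_addA : associative subquot_add.
Proof.
elim/cosetW=> x Bx; elim/cosetW=> y By; elim/cosetW=> z Bz.
by rewrite !cosetD ?addrA //; apply: BD.
Qed.

Fact subquot_addC : commutative subquot_add.
Proof. by move=> u v; rewrite /subquot_add addrC. Qed.

Fact subquot_add0 : left_id (coset 0) subquot_add.
Proof. by elim/cosetW=> x Bx; rewrite cosetD ?add0r //; apply: subspace0. Qed.

Fact subquot_addN : left_inverse (coset 0) subquot_opp subquot_add.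
Proof. by elim/cosetW=> x Bx; rewrite cosetN // cosetD ?addNr //; apply: BN. Qed.

HB.instance Definition _ := GRing.isZmodule.Build subquot
  subquot_addA subquot_addC subquot_add0 subquot_addN.

Lemma coset_add x y : B x -> B y -> coset x + coset y = coset (x + y).
Proof. exact: cosetD. Qed.

Fact subquot_scaleA a b u : subquot_scale a (subquot_scale b u) = subquot_scale (a * b) u.
Proof. by elim/cosetW: u => x Bx; rewrite !cosetZ ?scalerA //; apply: BZ. Qed.

Fact subquot_scale1 : left_id 1 subquot_scale.
Proof. by elim/cosetW=> x Bx; rewrite cosetZ ?scale1r. Qed.

Fact subquot_scaleDr : right_distributive subquot_scale +%R.
Proof.
move=> a; elim/cosetW=> x Bx; elim/cosetW=> y By.
by rewrite coset_add // !cosetZ ?coset_add ?scalerDr //; (exact: BZ || exact: BD).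
Qed.

Fact subquot_scaleDl u : {morph subquot_scale^~ u : a b / a + b}.
Proof.
elim/cosetW: u => x Bx a b.
by rewrite !cosetZ // coset_add ?scalerDl //; apply: BZ.
Qed.

HB.instance Definition _ := GRing.Zmodule_isLmodule.Build F subquot
  subquot_scaleA subquot_scale1 subquot_scaleDr subquot_scaleDl.

Lemma coset_linear a x y : B x -> B y -> coset (a *: x + y) = a *: coset x + coset y.
Proof. by move=> Bx By; rewrite -coset_add -?cosetZ //; apply: BZ. Qed.

Fact subquot_mul_linearl a u v w :
  subquot_mul (a *: u + v) w = a *: subquot_mul u w + subquot_mul v w.
Proof.
elim/cosetW: u => x Bx; elim/cosetW: v => y By; elim/cosetW: w => z Bz.
rewrite -coset_linear // !cosetM //; last exact/BD/By/BZ.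
by rewrite -coset_linear ?nmulDl ?nmulZl //; apply: BM.
Qed.

Fact subquot_mul_linearr a u v w :
  subquot_mul w (a *: u + v) = a *: subquot_mul w u + subquot_mul w v.
Proof.
elim/cosetW: u => x Bx; elim/cosetW: v => y By; elim/cosetW: w => z Bz.
rewrite -coset_linear // !cosetM //; last exact/BD/By/BZ.
by rewrite -coset_linear ?nmulDr ?nmulZr //; apply: BM.
Qed.

Definition subquot_nalg : nalgType F :=
  nalg_of_mul subquot_mul_linearl subquot_mul_linearr.

End Subquotient.

(** * Direct products of algebras *)

Section DirectProduct.
Variables (F : fieldType) (T : Type) (A : T -> nalgType F).

Definition dprod := forall t, A t.
Implicit Types x y z : dprod.

HB.instance Definition _ := gen_eqMixin dprod.
HB.instance Definition _ := gen_choiceMixin dprod.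

Definition dprod_add x y : dprod := fun t => x t + y t.
Definition dprod_opp x : dprod := fun t => - x t.
Definition dprod_scale a x : dprod := fun t => a *: x t.
Definition dprod_mul x y : dprod := fun t => x t ** y t.

Let ext x y : (forall t, x t = y t) -> x = y.
Proof. exact: functional_extensionality_dep. Qed.

Fact dprod_addA : associative dprod_add.
Proof. by move=> x y z; apply: ext => t; apply: addrA. Qed.
Fact dprod_addC : commutative dprod_add.
Proof. by move=> x y; apply: ext => t; apply: addrC. Qed.
Fact dprod_add0 : left_id (fun=> 0 : A _) dprod_add.
Proof. by move=> x; apply: ext => t; apply: add0r. Qed.
Fact dprod_addN : left_inverse (fun=> 0 : A _) dprod_opp dprod_add.
Proof. by move=> x; apply: ext => t; apply: addNr. Qed.

HB.instance Definition _ := GRing.isZmodule.Build dprod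
  dprod_addA dprod_addC dprod_add0 dprod_addN.

Fact dprod_scaleA a b x : dprod_scale a (dprod_scale b x) = dprod_scale (a * b) x.
Proof. by apply: ext => t; apply: scalerA. Qed.
Fact dprod_scale1 : left_id 1 dprod_scale.
Proof. by move=> x; apply: ext => t; apply: scale1r. Qed.
Fact dprod_scaleDr : right_distributive dprod_scale +%R.
Proof. by move=> a x y; apply: ext => t; apply: scalerDr. Qed.
Fact dprod_scaleDl x : {morph dprod_scale^~ x : a b / a + b}.
Proof. by move=> a b; apply: ext => t; apply: scalerDl. Qed.

HB.instance Definition _ := GRing.Zmodule_isLmodule.Build F dprod
  dprod_scaleA dprod_scale1 dprod_scaleDr dprod_scaleDl.

Fact dprod_mul_linearl a x y z :
  dprod_mul (a *: x + y) z = a *: dprod_mul x z + dprod_mul y z.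
Proof. by apply: ext => t; rewrite /dprod_mul nmulDl nmulZl. Qed.
Fact dprod_mul_linearr a x y z :
  dprod_mul z (a *: x + y) = a *: dprod_mul z x + dprod_mul z y.
Proof. by apply: ext => t; rewrite /dprod_mul nmulDr nmulZr. Qed.

Definition dprod_nalg : nalgType F :=
  nalg_of_mul dprod_mul_linearl dprod_mul_linearr.

Lemma dprod_proj_hom t : is_nalg_hom ((fun x => x t) : dprod_nalg -> A t).
Proof. by []. Qed.

End DirectProduct.

(** * Semidirect complements and separating homomorphisms *)

Section Complements.
Variable F : fieldType.
Implicit Types A P Q : nalgType F.

Lemma ideal0 A (B : set A) : is_subalgebra B -> is_ideal_of B [set 0].
Proof.
move=> [[B0 _] _]; split; first by move=> _ ->.
- by split=> [//|a _ _ -> ->] /=; rewrite scaler0 addr0.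
- by move=> b _ _ -> /=; rewrite nmul0l nmul0r.
Qed.

Lemma ideal_ker P Q (f : P -> Q) :
  is_nalg_hom f -> is_ideal_of [set: P] (f @^-1` [set 0]).
Proof.
move=> hf; split=> //; first split=> [|a x y] /=.
- by rewrite (hom0 hf).
- by rewrite hf.1 => -> ->; rewrite scaler0 addr0.
- by move=> b i _ /= fi; rewrite !(homM hf) fi nmul0l nmul0r.
Qed.

(** Elementwise form of complementation, by congruence modulo [I], which spares later proofs the
    equations between sets. *)
Lemma complementableI A (B I C : set A) :
  is_subspace B -> I `<=` B -> is_subspace I -> is_subalgebra C -> C `<=` B ->
  (forall b, B b -> exists2 c, C c & I (b - c)) ->
  (forall x, C x -> I x -> x = 0) -> semidirectly_complementable B I.
Proof.
move=> sB IB sI sC CB BCI CI0; exists C; split=> //.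
- apply/seteqP; split=> [b /BCI[c Cc Ibc]|_ [c Cc [i Ii <-]]].
    by exists c => //; exists (b - c) => //; rewrite addrC subrK.
  by apply: subspaceD => //; [apply: CB|apply: IB].
- apply/seteqP; split=> [x [Cx Ix]|_ ->]; first exact: CI0.
  by split; apply: subspace0 => //; case: sC.
Qed.

Lemma complementableE A (B I : set A) :
  semidirectly_complementable B I -> exists C, [/\ is_subalgebra C, C `<=` B,
    forall b, B b -> exists2 c, C c & I (b - c) &
    forall x, C x -> I x -> x = 0].
Proof.
move=> [C [sC CB BE CI0]]; exists C; split=> // [b|x Cx Ix].
  by rewrite {1}BE => -[c Cc [i Ii <-]]; exists c => //; rewrite addrC addKr.
by have : (C `&` I) x by []; rewrite CI0.
Qed.

(** Restricted to a complement of its kernel, [f] is a bijection onto [Q]; the section is the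
    inverse of this restriction. *)
Lemma complement_ker_section P Q (f : P -> Q) :
  is_nalg_hom f -> (forall y, exists x, f x = y) ->
  semidirectly_complementable [set: P] (f @^-1` [set 0]) ->
  exists2 s : Q -> P, is_nalg_hom s & cancel s f.
Proof.
move=> hf surj_f /complementableE[C [sC _ split_C inj_C]].
have ex_s y : exists x, C x /\ f x = y.
  have [x <-] := surj_f y; have [c Cc /= fxc] := split_C x I.
  by exists c; split=> //; apply/esym/eqP; rewrite -subr_eq0 -(homB hf) fxc.
have [s sP] := choice ex_s; have sK y : f (s y) = y by case: (sP y).
(* Uniqueness of preimages in [C] makes [s] a homomorphism: [s (a *: x + y)] and [a *: s x + s y]
   lie in [C] over the same element, and likewise for products. *)
have s_uniq x y : C x -> f x = y -> s y = x.
  move=> Cx fx; apply/eqP; rewrite -subr_eq0; apply/eqP/inj_C.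
    by apply: subspaceB => //; [case: sC|case: (sP y)].
  by rewrite /= (homB hf) sK fx subrr.
exists s => //; split=> [a x y|x y]; apply: s_uniq.
- by apply: sC.1.2; [case: (sP x)|case: (sP y)].
- by rewrite hf.1 !sK.
- by apply: sC.2; [case: (sP x)|case: (sP y)].
- by rewrite (homM hf) !sK.
Qed.

(* If p(C1) complements p(I) in p(D), then D = E + I for the preimage E of C1
   in D, and E `&` I lies in the kernel of p, so that it is separated by the
   remaining homomorphisms. *)
Lemma separated_complementable A (J : eqType) (N : J -> nalgType F)
    (p : forall t, A -> N t) (ts : seq J) :
  (forall t, is_nalg_hom (p t)) -> (forall t, nice (N t)) ->
  forall D I : set A, is_subalgebra D -> is_ideal_of D I ->
    (forall x, I x -> (forall t, t \in ts -> p t x = 0) -> x = 0) ->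
    semidirectly_complementable D I.
Proof.
move=> hp niceN; elim: ts => [|t ts IH] D I sD idI sepI; have [ID sI Im] := idI.
  (* With no homomorphism left, [sepI] forces the ideal to be zero, and [D] complements it. *)
  apply: (@complementableI _ D I D) => // [|b Db|x _ Ix].
  - by case: sD.
  - by exists b => //; rewrite subrr; apply: subspace0.
  - exact: sepI.
have [C1 [sC1 C1D split1 inj1]] := complementableE
  (niceN t _ _ (image_subalgebra (hp t) sD) (image_ideal (hp t) idI)).
pose E := D `&` p t @^-1` C1.
have sE : is_subalgebra E by apply: subalgebraI => //; apply: preimage_subalgebra.
have idE : is_ideal_of E (E `&` I).
  split; first by move=> x [].
    split; first by split; apply: subspace0 => //; case: sE.
    by move=> a x y [Ex Ix] [Ey Iy]; split; [apply: sE.1.2|apply: sI.2].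
  move=> b i [Db C1b] [Ei Ii]; have [bi ib] := Im _ _ Db Ii.
  by split; split=> //; apply: sE.2.
have ker_EI x : E x -> I x -> p t x = 0.
  by move=> [_ C1x] Ix; apply: inj1 => //; exists x.
have /complementableE[C [sC CE splitC injC]] : semidirectly_complementable E (E `&` I).
  apply: IH => // x [Ex Ix] px; apply: sepI => // t'.
  by rewrite in_cons => /predU1P[->|/px //]; apply: ker_EI.
apply: (@complementableI _ D I C) => //.
- by case: sD.
- by move=> x /CE[].
(* Subtracting an [i] in [I] whose image is [p t d - c1] moves [d] into [E], where [C] already
   complements; [i] is absorbed into the ideal part afterwards. *)
- move=> d Dd; have [|c1 C1c1 [i Ii pi]] := split1 (p t d); first by exists d.
  have Ei : E (d - i).
    split; first by apply: subspaceB => //; [case: sD|apply: ID].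
    by rewrite /= (homB (hp t)) pi subKr.
  have [c Cc [_ Ic]] := splitC _ Ei; exists c => //.
  by rewrite -(subrK i (d - c)) (addrAC d); apply: subspaceD.
- by move=> x Cx Ix; apply: injC => //; split=> //; exact: (CE _ Cx).
Qed.

(** Points are separated on all of [A], hence on every ideal of every subalgebra, and finiteness of
    [J] supplies the list for the induction. *)
Lemma separated_nice A (J : finType) (N : J -> nalgType F)
    (p : forall t, A -> N t) :
  (forall t, is_nalg_hom (p t)) -> (forall t, nice (N t)) ->
  (forall x, (forall t, p t x = 0) -> x = 0) -> nice A.
Proof.
move=> hp niceN sep B I sB idI.
apply: (@separated_complementable A J N p (enum J)) => // x _ px.
by apply: sep => t; apply: px; rewrite mem_enum.
Qed.

End Complements.

(** * Subalgebras as algebras, and their quotient maps *)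

Section Subalgebras.
Variables (F : fieldType) (A : nalgType F) (B : set A).
Hypothesis subB : is_subalgebra B.

(** Taken as the quotient by the zero ideal, so that one construction serves subalgebras and
    quotients alike. *)
Definition subalg : nalgType F := subquot_nalg subB (ideal0 subB).

Definition to_subalg (x : A) : subalg := coset subB (ideal0 subB) x.
Definition of_subalg (u : subalg) : A := val u.

Lemma to_subalgK x : B x -> of_subalg (to_subalg x) = x.
Proof.
by move=> Bx; apply/esym/eqP; rewrite -subr_eq0; apply/eqP/(val_cosetP subB (ideal0 subB)).
Qed.

Lemma of_subalgK : cancel of_subalg to_subalg.
Proof. by move=> u; apply: coset_valK. Qed.

Lemma of_subalg_in u : B (of_subalg u).
Proof. exact: subquot_val. Qed.

Lemma of_subalg_hom : is_nalg_hom of_subalg.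
Proof.
split=> [a u v|u v].
  rewrite -[u]of_subalgK -[v]of_subalgK -coset_linear; try exact: of_subalg_in.
  by rewrite -/(to_subalg _) !to_subalgK //; try apply: subB.1.2; apply: of_subalg_in.
by apply: to_subalgK; apply: subB.2; apply: of_subalg_in.
Qed.

Section Quotient.
Variable I : set A.
Hypothesis idI : is_ideal_of B I.

Definition subalg_coset (u : subalg) : subquot_nalg subB idI :=
  coset subB idI (of_subalg u).

Lemma subalg_coset_hom : is_nalg_hom subalg_coset.
Proof.
have [hl hm] := of_subalg_hom; split=> [a u v|u v]; rewrite /subalg_coset.
  by rewrite hl coset_linear //; apply: of_subalg_in.
by rewrite hm -cosetM //; apply: of_subalg_in.
Qed.

Lemma subalg_coset_surj v : exists u, subalg_coset u = v.
Proof.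
exists (to_subalg (val v)); rewrite /subalg_coset to_subalgK ?coset_valK //.
exact: subquot_val.
Qed.

Lemma subquot_finite : finite_nalg A -> finite_nalg (subquot_nalg subB idI).
Proof.
move=> /(finite_image (coset subB idI)); apply: sub_finite_set => v _.
by exists (val v) => //; apply: coset_valK.
Qed.

End Quotient.

End Subalgebras.

(** * Identities, polynomial evaluation and generators *)

Section Identities.
Variable F : fieldType.
Implicit Types A P Q : nalgType F.

Lemma satisfies_identity_inj P Q (f : P -> Q) n (v : napoly F n) :
  is_nalg_hom f -> injective f -> satisfies_identity Q v -> satisfies_identity P v.
Proof. by move=> hf inj_f Qv e; apply: inj_f; rewrite (hom_napoly_eval hf) Qv (hom0 hf). Qed.

Lemma satisfies_identity_surj P Q (f : P -> Q) n (v : napoly F n) :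
  is_nalg_hom f -> (forall y, exists x, f x = y) ->
  satisfies_identity P v -> satisfies_identity Q v.
Proof.
move=> hf /choice[g gK] Pv e; have -> : e = f \o (g \o e).
  by apply/funext => i /=; rewrite gK.
by rewrite -(hom_napoly_eval hf) Pv (hom0 hf).
Qed.

(** Represents av + w: lists of terms are not normalised, so concatenation serves as addition. *)
Definition napoly_lin n (a : F) (v w : napoly F n) : napoly F n :=
  [seq (a * c.1, c.2) | c <- v] ++ w.

Definition napoly_mul n (v w : napoly F n) : napoly F n :=
  [seq (c.1 * d.1, NProd c.2 d.2) | c <- v, d <- w].

Section Evaluation.
Variables (A : nalgType F) (n : nat) (e : 'I_n -> A).
Implicit Types v w : napoly F n.

Lemma napoly_eval_lin a v w :
  napoly_eval e (napoly_lin a v w) = a *: napoly_eval e v + napoly_eval e w.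
Proof.
rewrite /napoly_eval big_cat big_map scaler_sumr; congr (_ + _).
by apply: eq_bigr => c _; rewrite scalerA.
Qed.

Lemma napoly_eval_mul v w :
  napoly_eval e (napoly_mul v w) = napoly_eval e v ** napoly_eval e w.
Proof.
rewrite /napoly_eval big_allpairs_dep /=.
rewrite (big_morph (fun x => x ** _) (fun x y => nmulDl x y _) (nmul0l _)).
apply: eq_bigr => c _; rewrite (big_morph _ (nmulDr _) (nmul0r _)).
by apply: eq_bigr => d _; rewrite nmulZl nmulZr scalerA.
Qed.

Lemma napoly_eval_var i : napoly_eval e [:: (1, NVar i)] = e i.
Proof. by rewrite /napoly_eval big_seq1 scale1r. Qed.

(** This is the subalgebra generated by the entries of [e]. *)
Definition napoly_span : set A := range (napoly_eval e).

Lemma napoly_span_subalgebra : is_subalgebra napoly_span.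
Proof.
split; first split.
- by exists [::] => //; rewrite /napoly_eval big_nil.
- by move=> a _ _ [v _ <-] [w _ <-]; exists (napoly_lin a v w); rewrite ?napoly_eval_lin.
- by move=> _ _ [v _ <-] [w _ <-]; exists (napoly_mul v w); rewrite ?napoly_eval_mul.
Qed.

Lemma subalgebra_napoly_eval (S : set A) v :
  is_subalgebra S -> (forall i, S (e i)) -> S (napoly_eval e v).
Proof.
move=> [sS Sm] Se; apply: subspace_sum => // c; apply: subspaceZ => //.
by elim: c.2 => //= u Su w Sw; apply: Sm.
Qed.

Lemma napoly_eval_surj :
  generates (range e) -> forall x : A, exists v, napoly_eval e v = x.
Proof.
move=> gen_e x.
have /gen_e spanT := napoly_span_subalgebra.
suff : napoly_span x by case=> v; exists v.
rewrite spanT // => _ [i _ <-]; exists [:: (1, NVar i)] => //.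
exact: napoly_eval_var.
Qed.

End Evaluation.

(** An element of the span has the form v(e), which is the value of v at the lifted entries; any
    subalgebra containing these contains that value. *)
Lemma subalg_napoly_eval A n (e : 'I_n -> A) :
  let S := napoly_span_subalgebra e in
  generates (range (fun i => to_subalg S (e i))) /\
  forall i, of_subalg (to_subalg S (e i)) = e i.
Proof.
move=> S.
have eK i : of_subalg (to_subalg S (e i)) = e i.
  by apply: to_subalgK; exists [:: (1, NVar i)] => //; apply: napoly_eval_var.
split=> // C sC genC; apply/seteqP; split=> // u _.
have [v _ vE] := of_subalg_in u.
rewrite -[u]of_subalgK -vE.
have -> : napoly_eval e v = of_subalg (napoly_eval (fun i => to_subalg S (e i)) v).
  rewrite (hom_napoly_eval (of_subalg_hom S)).
  by congr (napoly_eval _ v); apply/funext => i /=; rewrite eK.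
rewrite of_subalgK; apply: subalgebra_napoly_eval => // i.
by apply: genC; exists i.
Qed.

(* The extension sends v(x) to v(e), which is well defined because every
   relation v(x) = 0 is an identity of P. *)
Lemma relations_extend A P n (x : 'I_n -> A) (e : 'I_n -> P) :
  generates (range x) ->
  (forall v, napoly_eval x v = 0 -> napoly_eval e v = 0) ->
  exists2 h : A -> P, is_nalg_hom h & forall i, h (x i) = e i.
Proof.
move=> /napoly_eval_surj/choice[q qK] rel.
have hE v : napoly_eval e (q (napoly_eval x v)) = napoly_eval e v.
  (* [w] and [v] agree at [x], so their difference, encoded as [napoly_lin (-1) v w], is a relation
     and vanishes at [e]. *)
  set w := q _; apply/eqP; rewrite -subr_eq0 addrC -scaleN1r -napoly_eval_lin.
  by apply/eqP/rel; rewrite napoly_eval_lin qK scaleN1r addNr.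
exists (fun u => napoly_eval e (q u)) => [|i]; last first.
  by rewrite -[x i](napoly_eval_var x) hE napoly_eval_var.
split=> [a u v|u v]; rewrite -[in LHS](qK u) -[in LHS](qK v).
  by rewrite -napoly_eval_lin hE napoly_eval_lin.
by rewrite -napoly_eval_mul hE napoly_eval_mul.
Qed.

(** The equalizer of [f] and [g] is a subalgebra containing [X]. *)
Lemma hom_eq_on_generators P Q (X : set P) (f g : P -> Q) :
  generates X -> is_nalg_hom f -> is_nalg_hom g ->
  (forall x, X x -> f x = g x) -> f =1 g.
Proof.
move=> genX hf hg fg x.
have : [set: P] x by []; rewrite -(genX _ (equalizer_subalgebra hf hg)) //.
Qed.

End Identities.

(** * Closure properties of the variety, and lifting from projective algebras *)

Section Varieties.
Variables (F : fieldType) (J : Type) (A : J -> nalgType F).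
Implicit Types P Q B : nalgType F.
Let V := generated_variety A.

Lemma variety_generator j : V (A j).
Proof. by move=> n v; apply. Qed.

Lemma variety_subalg P (S : set P) (subS : is_subalgebra S) : V P -> V (subalg subS).
Proof.
move=> VP n v /VP; apply: satisfies_identity_inj (of_subalg_hom subS) _.
exact: can_inj (@of_subalgK _ _ _ subS).
Qed.

Lemma variety_subquot P (S I : set P) (subS : is_subalgebra S) (idI : is_ideal_of S I) :
  V P -> V (subquot_nalg subS idI).
Proof.
move=> VP n v Av; apply: satisfies_identity_surj (subalg_coset_hom subS idI) _ _.
  exact: subalg_coset_surj.
exact: variety_subalg Av.
Qed.

Lemma variety_dprod (T : Type) (idx : T -> J) : V (dprod_nalg (fun t => A (idx t))).
Proof.
move=> n v Av e; apply: functional_extensionality_dep => t.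
rewrite (hom_napoly_eval (@dprod_proj_hom _ _ (fun t => A (idx t)) t)).
exact: Av.
Qed.

(** Preimages under [f] of the elements [r x], for free generators [x], define [h] from the free
    algebra to [P]. Then [f \o h] and [r] agree on generators, hence everywhere, so [h \o s] splits
    [f]. *)
Lemma projective_section B P (f : P -> B) :
  projective_in V B -> V P -> is_nalg_hom f -> (forall y, exists x, f x = y) ->
  exists2 g : B -> P, is_nalg_hom g & cancel g f.
Proof.
move=> [_ [L [X [s [r [[_ genX ext] hs hr sK]]]]]] VP hf /choice[g gK].
have [h [hh hX]] := ext P (g \o r) VP.
exists (h \o s); first exact: hom_comp hs hh.
move=> b /=; rewrite -[RHS]sK; apply: (hom_eq_on_generators (X := X) (f := f \o h)) => //.
- exact: hom_comp hh hf.
- by move=> x Xx /=; rewrite hX ?inE //= gK.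
Qed.

(** Projectivity is applied to the quotients D/I, which are finite members of the variety, rather
    than to [B] itself. *)
Lemma projective_quotients_nice B : V B -> finite_nalg B ->
  (forall Q, V Q -> finite_nalg Q -> projective_in V Q) -> nice B.
Proof.
move=> VB finB projV D I sD idI; have [ID sI _] := idI.
have [g hg gK] := projective_section
  (projV _ (variety_subquot (subS := sD) (idI := idI) VB) (subquot_finite sD idI finB))
  (variety_subalg (subS := sD) VB) (subalg_coset_hom sD idI) (@subalg_coset_surj _ _ _ sD _ idI).
have hog := hom_comp hg (of_subalg_hom sD).
apply: (@complementableI _ B D I (range (@of_subalg _ _ _ sD \o g))) => //.
- exact: sD.1.
- exact: image_subalgebra hog _ (subalgebraT _).
- by move=> _ [q _ <-]; apply: of_subalg_in.
- move=> d Dd; exists (of_subalg (g (coset sD idI d))); first by exists (coset sD idI d).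
  apply/(coset_eq sD idI) => //; first exact: of_subalg_in.
  by rewrite -[RHS]/(subalg_coset idI _) gK.
- move=> _ [q _ <-] /= Iq.
  (* The class of [of_subalg (g q)] is [q] since [g] is a section; an element of [I] has class
     zero. *)
  suff -> : q = 0 by rewrite (hom0 hg) (hom0 (of_subalg_hom sD)).
  rewrite -[LHS]gK -[RHS]/(coset sD idI 0); apply/(coset_eq sD idI).
  - exact: of_subalg_in.
  - exact: subspace0 sD.1.
  - by rewrite subr0.
Qed.

End Varieties.

(** * Relatively free algebras of finite rank *)

Lemma finite_nalg_enum (F : fieldType) (A : nalgType F) :
  finite_nalg A -> exists k (s : 'I_k -> A), forall x, exists i, s i = x.
Proof.
move=> /finite_seqP[s sE]; exists (size s), (fun i => nth 0 s i) => x.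
have xs : x \in s by have : [set: A] x by []; rewrite sE.
have lt_x : (index x s < size s)%N by rewrite index_mem.
by exists (Ordinal lt_x); rewrite /= nth_index.
Qed.

(* The algebra of n-ary polynomial functions on the A_j: the subalgebra of the
   product of copies of the A_j, one for each map 'I_n -> A_j, generated by
   the n coordinate tuples. *)
Lemma finitely_separated_free (F : fieldType) (J : finType)
    (A : J -> nalgType F) (n : nat) :
  (forall j, finite_nalg (A j)) ->
  exists (L : nalgType F) (x : 'I_n -> L) (T : finType) (idx : T -> J)
      (p : forall t, L -> A (idx t)),
    [/\ generated_variety A L, generates (range x),
      (forall (P : nalgType F) (e : 'I_n -> P), generated_variety A P ->
        exists2 h : L -> P, is_nalg_hom h & forall i, h (x i) = e i),
      forall t, is_nalg_hom (p t) &
      forall u, (forall t, p t u = 0) -> u = 0].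
Proof.
move=> finA.
(* The carrier of [A j] need not be a [finType]. Coding its elements by ordinals, possibly with
   repetitions, makes the type [T] of all assignments of the n variables finite. *)
have enumA j : {k & {s : 'I_k -> A j | forall y, exists i, s i = y}}.
  by have /cid[k /cid] := finite_nalg_enum (finA j); exists k.
pose k j := projT1 (enumA j).
pose s j : 'I_(k j) -> A j := sval (projT2 (enumA j)).
have sP j y : exists i, s j i = y by apply: (svalP (projT2 (enumA j))).
pose T : finType := {j & {ffun 'I_n -> 'I_(k j)}}.
pose Pi := dprod_nalg (fun t : T => A (tag t)).
pose x i : Pi := fun t => s (tag t) (tagged t i).
pose S := napoly_span_subalgebra x.
have [genx xK] := subalg_napoly_eval x.
have hom_p t := hom_comp (of_subalg_hom S) (@dprod_proj_hom _ _ (fun t : T => A (tag t)) t).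
exists (subalg S), (fun i => to_subalg S (x i)), T, tag, (fun t (u : subalg S) => of_subalg u t).
split=> //.
- exact/variety_subalg/variety_dprod.
(* Any assignment [e] into [A j] is a coordinate [t] of the product, and a relation among the
   generators read at [t] says that [v] vanishes at [e]. *)
- move=> P e VP; apply: relations_extend => // v v0; apply: VP => j {}e.
  have [g gE] := choice (fun i => sP j (e i)).
  pose t : T := Tagged (fun j => {ffun 'I_n -> 'I_(k j)}) [ffun i => g i].
  have := hom_napoly_eval (hom_p t) (fun i => to_subalg S (x i)) v.
  rewrite v0 (hom0 (hom_p t)) => /esym; congr (_ = _); congr napoly_eval.
  by apply/funext => i /=; rewrite xK /x /= ffunE gE.
- move=> u u0; rewrite -[u]of_subalgK -[RHS]of_subalgK; congr to_subalg.
  by rewrite (hom0 (of_subalg_hom S)); apply: functional_extensionality_dep.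
Qed.

(** * Equivalence of projectivity and niceness, as a cycle of implications *)

Theorem theorem13 (F : fieldType) (m : nat) (A : 'I_m -> nalgType F)
    (finA : forall j : 'I_m, finite_nalg (A j)) :
  [<-> forall B : nalgType F,
         generated_variety A B -> finite_nalg B ->
         projective_in (generated_variety A) B;
       forall B : nalgType F,
         generated_variety A B -> finite_nalg B -> nice B;
       forall j : 'I_m, nice (A j)].
Proof.
tfae.
- by move=> projV B VB finB; apply: projective_quotients_nice VB finB projV.
- by move=> niceV j; apply: niceV => //; apply: variety_generator.
move=> niceA B VB finB; split=> //.
(* The free generators are indexed by a list of all elements of [B], which makes the induced map [r]
   onto [B] surjective. *)
have [n [b b_surj]] := finite_nalg_enum finB.
have [L [x [T [idx [p [VL genx ext hp sep]]]]]] := finitely_separated_free n finA.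
have niceL : nice L by apply: separated_nice hp _ sep.
have [r hr rx] := ext B b VB.
have [s hs sK] : exists2 s : B -> L, is_nalg_hom s & cancel s r.
  apply: complement_ker_section => //.
    by move=> y; have [i <-] := b_surj y; exists (x i).
  by apply: niceL; [apply: subalgebraT|apply: ideal_ker].
exists L, (range x), s, r; split=> //; split=> // P f VP.
(* A map on the generating set is transported to indices as [f \o x], so coincidences among the
   [x i] do no harm. *)
have [h hh hx] := ext P (f \o x) VP; exists h; split=> // _ /set_mem[i _ <-].
exact: hx.
Qed.
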